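(* Let $(X,\Sigma,\mu)$ be a complete $\sigma$-finite measure space, $\mathcal{A}\subseteq\Sigma$ a sub-$\sigma$-finite algebra, $E=E^{\mathcal{A}}$ the associated conditional expectation, and $u,w\in\mathcal{D}(E)$ such that $T=M_wEM_u$ is a bounded operator on $L^2(\Sigma)$. If $T$ belongs to the quasi-$\ast$-$A$-class, then $\sigma_p(M_wEM_u)=\sigma_{jp}(M_wEM_u)$.
   Context: For a sub-$\sigma$-finite algebra $\mathcal{A}\subseteq\Sigma$, $E=E^{\mathcal{A}}$ denotes the conditional expectation: for $f\geq 0$ measurable or $f\in L^2(\Sigma)$, $Ef$ is the unique $\mathcal{A}$-measurable function with $\int_A f\,d\mu=\int_A Ef\,d\mu$ for all $A\in\mathcal{A}$. $\mathcal{D}(E)=\{g\in L^0(\Sigma): E(|g|)\in L^0(\mathcal{A})\}$, where $L^0$ denotes a.e. finite measurable functions. $M_w$ is multiplication by $w$, so $M_wEM_u f=wE(uf)$. For a bounded operator $T$, $|T|=(T^*T)^{1/2}$; $T$ belongs to the quasi-$\ast$-$A$-class if $T^*|T^2|T\geq T^*|T^*|^2T$. $\sigma_p(T)$ is the set of $\lambda\in\mathbb{C}$ with a unit vector $x$ such that $(T-\lambda)x=0$; $\sigma_{jp}(T)$ (joint point spectrum) is the set of $\lambda$ with a unit vector $x$ such that $(T-\lambda)x=0$ and $(T^*-\bar\lambda)x=0$. *)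

(* Defs.v *)
(* mathcomp-analysis (measure theory, Lebesgue integral)
   + mathcomp-real-closed (complex numbers R[i]). *)
From HB Require Import structures.
From mathcomp Require Import all_boot all_order all_algebra.
From mathcomp Require Import all_classical all_reals all_analysis measurable_realfun.
From mathcomp Require Import complex.
Set Implicit Arguments. Unset Strict Implicit. Unset Printing Implicit Defensive.
Import Order.TTheory GRing.Theory Num.Theory.
Local Open Scope classical_set_scope.
Local Open Scope ring_scope.

Section Defs.
Context {R : realType} {d : measure_display} {X : measurableType d}.
Variable mu : {measure set X -> \bar R}.

Local Notation C := (R[i]).

(** complete measure: every subset of a null set is measurable *)
Definition complete_measure := measure_is_complete mu.

(** A is a sub-sigma-algebra of Sigma on which mu is sigma-finite *)
Definition sub_sigma_finite (A : set (set X)) :=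
  [/\ sigma_algebra setT A,
      A `<=` measurable &
      exists F : nat -> set X,
        [/\ forall n, A (F n), \bigcup_n F n = setT &
            forall n, (mu (F n) < +oo)%E]].

(** measurability with respect to the sub-sigma-algebra A *)
Definition A_measurable (A : set (set X)) (g : X -> \bar R) :=
  forall Y : set (\bar R), measurable Y -> A (g @^-1` Y).

(** complex valued Sigma-measurable functions *)
Definition cmeasurable (f : X -> C) :=
  measurable_fun setT (fun x => complex.Re (f x)) /\
  measurable_fun setT (fun x => complex.Im (f x)).

(** |z|^2 as a real number *)
Definition csq (z : C) : R := complex.Re z ^+ 2 + complex.Im z ^+ 2.

(** ||f||_2^2 as an extended real *)
Definition l2n2 (f : X -> C) : \bar R := (\int[mu]_x (csq (f x))%:E)%E.

Definition inL2 (f : X -> C) := cmeasurable f /\ (l2n2 f < +oo)%E.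

(** almost everywhere equality *)
Definition ae_eq (f g : X -> C) := {ae mu, forall x, f x = g x}.

(** g is a version of the conditional expectation E^A h of a nonnegative
    Sigma-measurable extended-real function h *)
Definition cexp_nonneg (A : set (set X)) (h g : X -> \bar R) :=
  [/\ forall x, (0 <= g x)%E, A_measurable A g &
      forall B, A B -> (\int[mu]_(x in B) h x = \int[mu]_(x in B) g x)%E].

Definition cabs (f : X -> C) : X -> \bar R := fun x => (Num.sqrt (csq (f x)))%:E.

(** D(E) = { g in L^0(Sigma) : E(|g|) in L^0(A) } *)
Definition in_DE (A : set (set X)) (g : X -> C) :=
  cmeasurable g /\
  exists e, cexp_nonneg A (cabs g) e /\ {ae mu, forall x, (e x < +oo)%E}.

(** h is a version of E^A g for g in D(E):
    E g = E (Re g)^+ - E (Re g)^- + i (E (Im g)^+ - E (Im g)^-) *)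
Definition cexp (A : set (set X)) (g h : X -> C) :=
  exists p1 n1 p2 n2 : X -> \bar R,
    [/\ cexp_nonneg A (fun x => (Num.max (complex.Re (g x)) 0)%:E) p1,
        cexp_nonneg A (fun x => (Num.max (- complex.Re (g x)) 0)%:E) n1,
        cexp_nonneg A (fun x => (Num.max (complex.Im (g x)) 0)%:E) p2,
        cexp_nonneg A (fun x => (Num.max (- complex.Im (g x)) 0)%:E) n2 &
        {ae mu, forall x, h x =
           Complex (fine (p1 x) - fine (n1 x)) (fine (p2 x) - fine (n2 x))}].

(** integral of a complex function over X (real and imaginary parts) *)
Definition cint (f : X -> C) : C :=
  Complex (Rintegral mu setT (fun x => complex.Re (f x)))
          (Rintegral mu setT (fun x => complex.Im (f x))).

(** inner product on L^2 *)
Definition ip (f g : X -> C) : C := cint (fun x => f x * (g x)^*).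

(** bounded linear operator on L^2(Sigma) (acting on representatives) *)
Definition bounded_op (S : (X -> C) -> (X -> C)) :=
  [/\ forall f, inL2 f -> inL2 (S f),
      forall f g, inL2 f -> inL2 g -> ae_eq f g -> ae_eq (S f) (S g),
      forall (a : C) f g, inL2 f -> inL2 g ->
        ae_eq (S (fun x => a * f x + g x)) (fun x => a * S f x + S g x) &
      exists M : R, forall f, inL2 f -> (l2n2 (S f) <= M%:E * l2n2 f)%E].

(** S is the Hilbert adjoint of the bounded operator T *)
Definition is_adjoint (T S : (X -> C) -> (X -> C)) :=
  bounded_op S /\ forall f g, inL2 f -> inL2 g -> ip (T f) g = ip f (S g).

(** positive (bounded) operator *)
Definition positive_op (P : (X -> C) -> (X -> C)) :=
  bounded_op P /\ forall f, inL2 f -> 0 <= ip (P f) f.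

(** T = M_w E M_u on L^2(Sigma): for f in L^2, uf in D(E) and
    T f = w E(uf) a.e. *)
Definition is_wEu (A : set (set X)) (w u : X -> C) (T : (X -> C) -> (X -> C)) :=
  forall f, inL2 f ->
    in_DE A (fun x => u x * f x) /\
    exists h, cexp A (fun x => u x * f x) h /\ ae_eq (T f) (fun x => w x * h x).

(** quasi-*-A class: T^* |T^2| T >= T^* |T^*|^2 T, where |T^2| is the
    positive square root of (T^2)^* T^2 and |T^*|^2 = T T^* *)
Definition quasi_star_A (T : (X -> C) -> (X -> C)) :=
  exists S Q P : (X -> C) -> (X -> C),
    [/\ is_adjoint T S, is_adjoint (fun f => T (T f)) Q,
        positive_op P,
        (forall f, inL2 f -> ae_eq (P (P f)) (Q (T (T f)))) &
        forall f, inL2 f ->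
          ip (S (T (S (T f)))) f <= ip (S (P (T f))) f].

(** point spectrum and joint point spectrum (S the adjoint of T) *)
Definition sigma_p (T : (X -> C) -> (X -> C)) : set C :=
  [set l | exists x, [/\ inL2 x, l2n2 x = 1%E & ae_eq (T x) (fun y => l * x y)]].

Definition sigma_jp (T S : (X -> C) -> (X -> C)) : set C :=
  [set l | exists x, [/\ inL2 x, l2n2 x = 1%E, ae_eq (T x) (fun y => l * x y)
                       & ae_eq (S x) (fun y => l^* * x y)]].

End Defs.

(* Main.v *)
(* For an eigenvector x of T with eigenvalue l != 0, the class inequality at x and
   Cauchy-Schwarz give |T^* x|^2 <= |T^2 x| |x| = |l|^2 |x|^2, so that
   |T^* x - l^* x|^2 <= 0.

   For l = 0 the structure T = M_w E M_u is needed. Let T x = 0, z = T^* x, y = T z.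
   T and T^* commute with multiplication by 1_B for B in the sub-sigma-algebra, and
   T y = phi y for some function phi measurable for the sub-sigma-algebra, since T y and
   y are multiples of w by such functions. On a cell B where |phi - c| <= e, the class
   inequality makes T^* (1_B y) close to c^* 1_B y, while 1_B x is orthogonal to the
   range of T^* and <1_B y, 1_B x> = |1_B z|^2; this yields |1_B z|^2 <= K e |1_B x|^2
   with K independent of B. Summing over a countable partition into cells and letting
   e tend to 0 gives z = 0. *)
Require Import Defs.
From HB Require Import structures.
From mathcomp Require Import all_boot all_order all_algebra.
From mathcomp Require Import all_classical all_reals all_analysis measurable_realfun.
From mathcomp Require Import complex.
From mathcomp Require Import ring lra.
Set Implicit Arguments. Unset Strict Implicit. Unset Printing Implicit Defensive.
Local Open Scope classical_set_scope.
Local Open Scope ring_scope.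

Import Order.TTheory GRing.Theory Num.Theory.

(** * Real and imaginary parts and squared modulus of complex numbers *)

Section ComplexParts.
Context {R : realType}.
Implicit Types a b z : R[i].

Lemma Re_add a b : complex.Re (a + b) = complex.Re a + complex.Re b.
Proof. by case: a; case: b. Qed.

Lemma Im_add a b : complex.Im (a + b) = complex.Im a + complex.Im b.
Proof. by case: a; case: b. Qed.

Lemma Re_opp a : complex.Re (- a) = - complex.Re a.
Proof. by case: a. Qed.

Lemma Im_opp a : complex.Im (- a) = - complex.Im a.
Proof. by case: a. Qed.

Lemma Re_mul a b : complex.Re (a * b) =
  complex.Re a * complex.Re b - complex.Im a * complex.Im b.
Proof. by case: a; case: b. Qed.

Lemma Im_mul a b : complex.Im (a * b) =
  complex.Re a * complex.Im b + complex.Im a * complex.Re b.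
Proof. by case: a; case: b. Qed.

Lemma Re_conj a : complex.Re (a^*) = complex.Re a.
Proof. by case: a. Qed.

Lemma Im_conj a : complex.Im (a^*) = - complex.Im a.
Proof. by case: a. Qed.

Definition ReImE := (Re_add, Im_add, Re_opp, Im_opp, Re_mul, Im_mul, Re_conj, Im_conj).

Lemma complexP a b :
  complex.Re a = complex.Re b -> complex.Im a = complex.Im b -> a = b.
Proof. by case: a b => [? ?] [? ?] /= -> ->. Qed.

Lemma csq_ge0 z : 0 <= csq z.
Proof. by rewrite addr_ge0 ?sqr_ge0. Qed.

Lemma csqM a b : csq (a * b) = csq a * csq b.
Proof. rewrite /csq !ReImE; ring. Qed.

Lemma csq_conj a : csq (a^*) = csq a.
Proof. by rewrite /csq !ReImE sqrrN. Qed.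

Lemma csq_eq0 z : csq z = 0 -> z = 0.
Proof.
move/eqP; rewrite /csq paddr_eq0 ?sqr_ge0 // !sqrf_eq0 => /andP[/eqP ? /eqP ?].
exact: complexP.
Qed.

Lemma csqD_le a b : csq (a + b) <= 2 * csq a + 2 * csq b.
Proof.
rewrite /csq !ReImE.
have := sqr_ge0 (complex.Re a - complex.Re b).
have := sqr_ge0 (complex.Im a - complex.Im b); nra.
Qed.

End ComplexParts.

(** One operation covers sums, differences and, through [scaleE], multiples; it has the shape of the
    linearity clause of [bounded_op]. *)
Definition lincomb {R : realType} {X : Type} (a : R[i]) (f g : X -> R[i]) : X -> R[i] :=
  fun x => a * f x + g x.

(** * Square integrable functions and their inner product *)

Section L2.
Context {R : realType} {d : measure_display} {X : measurableType d}.
Context (mu : {measure set X -> \bar R}).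
Implicit Types (f g h F G : X -> R[i]) (a : R[i]).

Local Notation Rpart f := (fun x => complex.Re (f x)).
Local Notation Ipart f := (fun x => complex.Im (f x)).

Definition cintegrable F :=
  mu.-integrable setT (EFin \o Rpart F) /\ mu.-integrable setT (EFin \o Ipart F).

Lemma cint_lincomb a F G : cintegrable F -> cintegrable G ->
  cint mu (lincomb a F G) = a * cint mu F + cint mu G.
Proof.
move=> [F1 F2] [G1 G2].
have Z (r : R) (k : X -> R) : mu.-integrable setT (EFin \o k) ->
    mu.-integrable setT (EFin \o (fun x => r * k x)).
  move=> ki; have -> : EFin \o (fun x => r * k x) = (fun x => r%:E * (EFin \o k) x)%E by [].
  exact: integrableZl.
have D (k l : X -> R) : mu.-integrable setT (EFin \o k) -> mu.-integrable setT (EFin \o l) ->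
    mu.-integrable setT (EFin \o (fun x => k x + l x)).
  move=> ki li; have -> : EFin \o (fun x => k x + l x) =
    (fun x => (EFin \o k) x + (EFin \o l) x)%E by [].
  exact: integrableD.
apply: complexP; rewrite !ReImE /=.
- rewrite (_ : (fun x => _) = fun x => (complex.Re a * complex.Re (F x)
     + (- complex.Im a) * complex.Im (F x)) + complex.Re (G x)); last first.
    by apply/funext => x; rewrite /lincomb !ReImE mulNr.
  rewrite RintegralD //; last exact/D/Z/F2/Z.
  rewrite RintegralD ?RintegralZl // ?mulNr //; exact: Z.
- rewrite (_ : (fun x => _) = fun x => (complex.Re a * complex.Im (F x)
     + (complex.Im a) * complex.Re (F x)) + complex.Im (G x)); last first.
    by apply/funext => x; rewrite /lincomb !ReImE.
  rewrite RintegralD //; last exact/D/Z/F1/Z.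
  rewrite RintegralD ?RintegralZl //; exact: Z.
Qed.

Lemma measurable_csq f : cmeasurable f -> measurable_fun setT (fun x => csq (f x)).
Proof.
by move=> [f1 f2]; apply: measurable_funD; apply: measurable_funX.
Qed.

Lemma cmeasurable_lincomb a f g :
  cmeasurable f -> cmeasurable g -> cmeasurable (lincomb a f g).
Proof.
move=> [f1 f2] [g1 g2]; split; rewrite /lincomb.
- under eq_fun do rewrite !ReImE.
  apply: measurable_funD => //; apply: measurable_funB; exact: measurable_funM.
- under eq_fun do rewrite !ReImE.
  apply: measurable_funD => //; apply: measurable_funD; exact: measurable_funM.
Qed.

Lemma l2n2_ge0 f : (0 <= l2n2 mu f)%E.
Proof. by apply: integral_ge0 => x _; rewrite lee_fin csq_ge0. Qed.

Lemma integrable_csq f : inL2 mu f -> mu.-integrable setT (EFin \o (fun x => csq (f x))).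
Proof.
move=> [fm flt]; apply/integrableP; split.
  by apply/measurable_EFinP; exact: measurable_csq.
apply: le_lt_trans flt; rewrite /l2n2; under eq_integral => x _.
  rewrite /= ger0_norm ?csq_ge0 //; over.
by [].
Qed.

Lemma inL2_le f (k : X -> R) : cmeasurable f ->
  mu.-integrable setT (EFin \o k) -> (forall x, csq (f x) <= k x) -> inL2 mu f.
Proof.
move=> fm ki fk; split => //.
have : mu.-integrable setT (EFin \o (fun x => csq (f x))).
  apply: (le_integrable _ _ _ ki) => //.
    by apply/measurable_EFinP; exact: measurable_csq.
  move=> x _; rewrite /= lee_fin ger0_norm ?csq_ge0 //.
  exact: le_trans (fk x) (ler_norm _).
move/integrableP => [_]; apply: le_lt_trans; rewrite /l2n2.
under eq_integral => x _ do rewrite -[csq (f x)]ger0_norm ?csq_ge0 //.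
by [].
Qed.

Lemma inL2_lincomb a f g : inL2 mu f -> inL2 mu g -> inL2 mu (lincomb a f g).
Proof.
move=> fL gL.
apply: (@inL2_le _ (fun x => (2 * csq a) * csq (f x) + 2 * csq (g x))).
- by apply: cmeasurable_lincomb; [case: fL|case: gL].
- have -> : EFin \o (fun x => (2 * csq a) * csq (f x) + 2 * csq (g x)) =
    (fun x => (2 * csq a)%:E * (EFin \o (fun x => csq (f x))) x +
       2%:E * (EFin \o (fun x => csq (g x))) x)%E by [].
  by apply: integrableD => //; apply: integrableZl => //; exact: integrable_csq.
- by move=> x; apply: le_trans (csqD_le _ _) _; rewrite csqM mulrA.
Qed.

(** Both parts of f times the conjugate of g are dominated by the integrable function |f|^2 +
    |g|^2. *)
Lemma ip_integrable f g : inL2 mu f -> inL2 mu g ->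
  cintegrable (fun x => f x * (g x)^*).
Proof.
move=> fL gL.
have ki : mu.-integrable setT (EFin \o (fun x => csq (f x) + csq (g x))).
  have -> : EFin \o (fun x => csq (f x) + csq (g x)) =
    (fun x => (EFin \o (fun x => csq (f x))) x + (EFin \o (fun x => csq (g x))) x)%E by [].
  by apply: integrableD => //; exact: integrable_csq.
have [[f1 f2] _] := fL; have [[g1 g2] _] := gL.
have kE x : `|csq (f x) + csq (g x)| = csq (f x) + csq (g x).
  by rewrite ger0_norm // addr_ge0 ?csq_ge0.
split.
- apply: (le_integrable _ _ _ ki) => //.
    apply/measurable_EFinP; under eq_fun do rewrite !ReImE mulrN opprK.
    by apply: measurable_funD; apply: measurable_funM.
  move=> x _; rewrite /= lee_fin kE ler_norml !ReImE /csq.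
  set p := complex.Re (f x); set q := complex.Im (f x).
  set r := complex.Re (g x); set s := complex.Im (g x).
  have := sqr_ge0 (p + r); have := sqr_ge0 (p - r).
  have := sqr_ge0 (q + s); have := sqr_ge0 (q - s).
  move=> ? ? ? ?; apply/andP; split; nra.
- apply: (le_integrable _ _ _ ki) => //.
    apply/measurable_EFinP; under eq_fun do rewrite !ReImE mulrN addrC.
    by apply: measurable_funB; apply: measurable_funM.
  move=> x _; rewrite /= lee_fin kE ler_norml !ReImE /csq.
  set p := complex.Re (f x); set q := complex.Im (f x).
  set r := complex.Re (g x); set s := complex.Im (g x).
  have := sqr_ge0 (p + s); have := sqr_ge0 (p - s).
  have := sqr_ge0 (q + r); have := sqr_ge0 (q - r).
  move=> ? ? ? ?; apply/andP; split; nra.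
Qed.

Lemma ip_lincombl a f g h : inL2 mu f -> inL2 mu g -> inL2 mu h ->
  ip mu (lincomb a f g) h = a * ip mu f h + ip mu g h.
Proof.
move=> fL gL hL; rewrite -cint_lincomb; try exact: ip_integrable.
by congr (cint mu _); apply/funext => x; rewrite /lincomb mulrDl mulrA.
Qed.

Lemma ip_conj f g : inL2 mu f -> inL2 mu g -> ip mu f g = (ip mu g f)^*.
Proof.
move=> fL gL; have [g1 g2] := ip_integrable gL fL.
apply: complexP; rewrite !ReImE /=.
  by congr Rintegral; apply/funext => x; rewrite !ReImE; ring.
rewrite -[RHS]mulN1r -RintegralZl //.
by congr Rintegral; apply/funext => x; rewrite !ReImE; ring.
Qed.

Lemma ip_lincombr a f g h : inL2 mu f -> inL2 mu g -> inL2 mu h ->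
  ip mu h (lincomb a f g) = a^* * ip mu h f + ip mu h g.
Proof.
move=> fL gL hL; rewrite ip_conj ?ip_lincombl //; last exact: inL2_lincomb.
by rewrite (ip_conj hL fL) (ip_conj hL gL) rmorphD rmorphM.
Qed.

(** [fine] turns an infinite integral into 0, so this is the squared norm only on L^2, as recorded
    by [n2E]. *)
Definition n2 f : R := fine (l2n2 mu f).

Lemma n2_ge0 f : 0 <= n2 f.
Proof. by rewrite fine_ge0 ?l2n2_ge0. Qed.

Lemma n2E f : inL2 mu f -> (n2 f)%:E = l2n2 mu f.
Proof. by move=> [_ fl]; rewrite fineK // ge0_fin_numE // l2n2_ge0. Qed.

Lemma ip_self f : ip mu f f = Complex (n2 f) 0.
Proof.
apply: complexP => /=.
  by congr (fine _); apply: eq_integral => x _; rewrite !ReImE /csq; congr EFin; ring.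
rewrite (_ : (fun x => _) = cst 0) ?/Rintegral ?integral0 //.
by apply/funext => x; rewrite !ReImE /=; ring.
Qed.

Lemma ae_ip f f' g g' : inL2 mu f -> inL2 mu f' -> inL2 mu g -> inL2 mu g' ->
  Defs.ae_eq mu f f' -> Defs.ae_eq mu g g' -> ip mu f g = ip mu f' g'.
Proof.
move=> fL fL' gL gL' ff gg.
have [i1 i2] := ip_integrable fL gL; have [j1 j2] := ip_integrable fL' gL'.
apply: complexP => /=; congr fine; apply: ae_eq_integral => //.
- exact: measurable_int i1.
- exact: measurable_int j1.
- by apply: filterS2 ff gg => x -> ->.
- exact: measurable_int i2.
- exact: measurable_int j2.
- by apply: filterS2 ff gg => x -> ->.
Qed.

Lemma ae_n2 f f' : inL2 mu f -> inL2 mu f' -> Defs.ae_eq mu f f' -> n2 f = n2 f'.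
Proof.
move=> fL fL' ff.
have : ip mu f f = ip mu f' f' by exact: ae_ip.
by rewrite !ip_self => -[].
Qed.

Lemma n2_eq0 f : inL2 mu f -> n2 f = 0 -> Defs.ae_eq mu f (fun=> 0).
Proof.
move=> fL f0; have [fm _] := fL.
have mf : measurable_fun setT (EFin \o (fun x => csq (f x))).
  by apply/measurable_EFinP; exact: measurable_csq.
have /(ae_eq_integral_abs mu measurableT mf) :
    (\int[mu]_x `|(EFin \o (fun x => csq (f x))) x| = 0)%E.
  under eq_integral => x _ do rewrite /= ger0_norm ?csq_ge0 //.
  by rewrite -[LHS](n2E fL) f0.
by apply: filterS => x /(_ I) [] /csq_eq0.
Qed.

End L2.

(** * The norm, Cauchy-Schwarz and the triangle inequality *)

Section Norm.
Context {R : realType} {d : measure_display} {X : measurableType d}.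
Context (mu : {measure set X -> \bar R}).
Implicit Types (f g h F G : X -> R[i]) (a : R[i]).

Lemma n2_lincomb a f g : inL2 mu f -> inL2 mu g ->
  n2 mu (lincomb a f g) =
    csq a * n2 mu f + 2 * complex.Re (a * ip mu f g) + n2 mu g.
Proof.
move=> fL gL; have lL := inL2_lincomb a fL gL.
have := ip_self mu (lincomb a f g).
rewrite ip_lincombl // !ip_lincombr // !ip_self (ip_conj gL fL) => /(congr1 (@complex.Re R)).
move: (ip mu f g) => t.
rewrite !ReImE /= => <-; rewrite /csq. ring.
Qed.

(** Using [f] twice brings multiples under the results on linear combinations without involving the
    zero function. *)
Lemma scaleE a f : (fun x => a * f x) = lincomb (a - 1) f f.
Proof. by apply/funext => x; rewrite /lincomb mulrBl mul1r subrK. Qed.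

Lemma inL2_scale a f : inL2 mu f -> inL2 mu (fun x => a * f x).
Proof. by move=> fL; rewrite scaleE; exact: inL2_lincomb. Qed.

Lemma n2_scale a f : inL2 mu f -> n2 mu (fun x => a * f x) = csq a * n2 mu f.
Proof.
move=> fL; rewrite scaleE n2_lincomb // ip_self /csq !ReImE /=; ring.
Qed.

(** Cauchy-Schwarz: with t the conjugate of <f, g>, the squared norm of g - s t f is a nonnegative
    quadratic polynomial in the real number s. *)
Lemma csq_ip_le f g : inL2 mu f -> inL2 mu g ->
  csq (ip mu f g) <= n2 mu f * n2 mu g.
Proof.
move=> fL gL; set q := csq _.
have key s : 0 <= s ^+ 2 * q * n2 mu f - 2 * s * q + n2 mu g.
  have := n2_ge0 mu (lincomb (Complex (- s) 0 * (ip mu f g)^*) f g).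
  rewrite n2_lincomb // /q; move: (ip mu f g) => t.
  rewrite /csq !ReImE /= => /le_trans; apply; rewrite le_eqVlt; apply/orP; left; apply/eqP; ring.
have q0 : 0 <= q := csq_ge0 _.
have f0 := n2_ge0 mu f; have g0 := n2_ge0 mu g.
move: f0; rewrite le_eqVlt => /orP[/eqP f0|f0].
  rewrite -f0 mul0r leNgt; apply/negP => qp.
  (* For |f| = 0 the polynomial is affine in s, and this s gives it the value -1. *)
  have := key ((n2 mu g + 1) / (2 * q)); rewrite -f0 mulr0 add0r.
  have -> : 2 * ((n2 mu g + 1) / (2 * q)) * q = n2 mu g + 1.
    by field; rewrite gt_eqF.
  lra.
(* The quadratic polynomial is minimal at s = 1 / |f|^2. *)
have := key (n2 mu f)^-1.
have -> : (n2 mu f)^-1 ^+ 2 * q * n2 mu f - 2 * (n2 mu f)^-1 * q + n2 mu g =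
  n2 mu g - q / n2 mu f by field; rewrite gt_eqF.
by rewrite subr_ge0 ler_pdivrMr // mulrC.
Qed.

Definition nrm f : R := Num.sqrt (n2 mu f).

Lemma nrm_ge0 f : 0 <= nrm f.
Proof. exact: sqrtr_ge0. Qed.

Lemma sqr_nrm f : nrm f ^+ 2 = n2 mu f.
Proof. by rewrite sqr_sqrtr // n2_ge0. Qed.

(** Triangle inequality: after squaring only the cross terms differ, and Cauchy-Schwarz bounds the
    one on the left. *)
Lemma nrm_lincomb a f g : inL2 mu f -> inL2 mu g ->
  nrm (lincomb a f g) <= Num.sqrt (csq a) * nrm f + nrm g.
Proof.
move=> fL gL; have f0 := nrm_ge0 f; have g0 := nrm_ge0 g.
have c0 : 0 <= Num.sqrt (csq a) by exact: sqrtr_ge0.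
rewrite -(@ler_pXn2r _ 2) ?nnegrE ?nrm_ge0 //; last by rewrite addr_ge0 // mulr_ge0.
rewrite sqr_nrm n2_lincomb // sqrrD exprMn sqr_sqrtr ?csq_ge0 // !sqr_nrm.
rewrite lerD2r lerD2l mulr_natl lerMn2r /=.
apply: le_trans (ler_norm _) _.
rewrite -(@ler_pXn2r _ 2) ?nnegrE ?normr_ge0 // ?mulr_ge0 //.
rewrite real_normK ?num_real // !exprMn sqr_sqrtr ?csq_ge0 // !sqr_nrm.
apply: (@le_trans _ _ (csq (a * ip mu f g))).
  by rewrite [leRHS]/csq lerDl sqr_ge0.
by rewrite csqM -mulrA ler_wpM2l ?csq_ge0 // csq_ip_le.
Qed.

Lemma ae_trans f g h : Defs.ae_eq mu f g -> Defs.ae_eq mu g h -> Defs.ae_eq mu f h.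
Proof. by move=> fg; apply: filterS2 fg => x -> ->. Qed.

Lemma ae_sym f g : Defs.ae_eq mu f g -> Defs.ae_eq mu g f.
Proof. by apply: filterS => x ->. Qed.

Lemma ae_nrm f g : inL2 mu f -> inL2 mu g -> Defs.ae_eq mu f g -> nrm f = nrm g.
Proof. by move=> fL gL fg; rewrite /nrm (ae_n2 fL gL fg). Qed.

Lemma n2_sub0 a f g : inL2 mu f -> inL2 mu g ->
  n2 mu (lincomb (- a) f g) <= 0 -> Defs.ae_eq mu g (fun x => a * f x).
Proof.
move=> fL gL le0.
have /n2_eq0 : inL2 mu (lincomb (- a) f g) by exact: inL2_lincomb.
have -> : n2 mu (lincomb (- a) f g) = 0 by apply/le_anti; rewrite le0 n2_ge0.
move=> /(_ erefl); apply: filterS => x /eqP.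
by rewrite /lincomb mulNr addrC subr_eq0 => /eqP.
Qed.

End Norm.

(** * Bounded operators, adjoints and consequences of the class inequality *)

Section Operator.
Context {R : realType} {d : measure_display} {X : measurableType d}.
Context (mu : {measure set X -> \bar R}).
Implicit Types (f g h F G : X -> R[i]) (a c : R[i]) (T S P Q : (X -> R[i]) -> X -> R[i]).

Lemma op_scale T a f : bounded_op mu T -> inL2 mu f ->
  Defs.ae_eq mu (T (fun x => a * f x)) (fun x => a * T f x).
Proof.
by move=> [_ _ lin _] fL; rewrite (scaleE a (T f)) (scaleE a f); exact: lin.
Qed.

Lemma op_nrm_bound T : bounded_op mu T ->
  exists2 M, 1 <= M & forall f, inL2 mu f -> nrm mu (T f) <= M * nrm mu f.
Proof.
(* The given [M] bounds squared norms; 1 + |M| is at least 1 and its square dominates [M]. *)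
move=> [TL _ _ [M MT]]; exists (1 + `|M|); first by rewrite lerDl.
move=> f fL; rewrite -(@ler_pXn2r _ 2) ?nnegrE ?nrm_ge0 ?mulr_ge0 ?nrm_ge0 //.
rewrite exprMn !sqr_nrm; have := MT f fL.
rewrite -!n2E //; last exact: TL.
rewrite -EFinM lee_fin => /le_trans; apply.
rewrite ler_wpM2r ?n2_ge0 //; have := ler_norm M; have := normr_ge0 M; nra.
Qed.

(** Polarization: nonnegativity in [R[i]] includes being real, and reality of the quadratic form at
    a f + g for a = 1 and a = i yields symmetry. *)
Lemma positive_op_sym P f g : positive_op mu P -> inL2 mu f -> inL2 mu g ->
  ip mu (P f) g = ip mu f (P g).
Proof.
move=> [[PL _ lin _] pos] fL gL; have PfL := PL _ fL; have PgL := PL _ gL.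
have im a : complex.Im (ip mu (lincomb a (P f) (P g)) (lincomb a f g)) = 0.
  have lL := inL2_lincomb a fL gL.
  have <- : ip mu (P (lincomb a f g)) (lincomb a f g) =
            ip mu (lincomb a (P f) (P g)) (lincomb a f g).
    apply: ae_ip => //; [exact: PL|exact: inL2_lincomb|exact: lin|exact: filterE].
  by have := pos _ lL; rewrite lecE => /andP[/eqP ].
have real h : inL2 mu h -> complex.Im (ip mu (P h) h) = 0.
  by move=> hL; have := pos _ hL; rewrite lecE => /andP[/eqP].
have := im 1; have := im (Complex 0 1).
rewrite !ip_lincombl ?ip_lincombr //; try exact: inL2_lincomb.
rewrite (ip_conj fL PgL); have := real f fL; have := real g gL.
move: (ip mu (P f) f) (ip mu (P f) g) (ip mu (P g) f) (ip mu (P g) g) => p q r s.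
rewrite !ReImE /= => h1 h2 h3 h4; apply: complexP; rewrite !ReImE; lra.
Qed.

(* With [y = T f], the class inequality at [f] reads [|S y|^2 <= <P y, y>],
   and [P^2 = (T^2)^* T^2] gives [|P y| = |T^2 y|]. *)
Lemma quasi_star_A_ineq T S f : is_adjoint mu T S -> quasi_star_A mu T ->
  bounded_op mu T -> inL2 mu f ->
  n2 mu (S (T f)) ^+ 2 <= n2 mu (T (T (T f))) * n2 mu (T f).
Proof.
move=> [[SL _ _ _] adjS] [S0 [Q [P [[[S0L _ _ _] adj0] [[QL _ _ _] adjQ] Ppos PP le]]]].
move=> [TL _ _ _] fL; have := Ppos => -[[PL _ _ _] pos].
set y := T f; have yL : inL2 mu y by exact: TL.
(* The class comes with its own adjoint [S0]. The adjoint relations give <S0 y, S y> = |S0 y|^2 and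
   <S y, S0 y> = |S y|^2, so the two norms agree. *)
have n2S : n2 mu (S0 y) = n2 mu (S y).
  have e1 := adj0 _ _ (S0L _ yL) yL; have e2 := adj0 _ _ (SL _ yL) yL.
  have e3 := adjS _ _ (S0L _ yL) yL; have e4 := adjS _ _ (SL _ yL) yL.
  move: e1 e4; rewrite e2 e3 (ip_conj (SL _ yL) (S0L _ yL)) !ip_self => e1 e4.
  by move: e4; rewrite e1 => /(congr1 (@complex.Re R)); rewrite ReImE.
have PyE : n2 mu (P y) = n2 mu (T (T y)).
  have := positive_op_sym Ppos yL (PL _ yL).
  rewrite (@ae_ip _ _ _ _ y y (P (P y)) (Q (T (T y)))) //; last exact: PP.
  - by rewrite -adjQ ?ip_self //; [move=> -[] | exact: TL _ (TL _ yL)].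
  - exact: PL _ (PL _ yL).
  - exact: QL _ (TL _ (TL _ yL)).
  - exact: filterE.
have := le f fL.
(* Moving the adjoints across turns the two sides of the class inequality into |S0 y|^2 and the
   conjugate of <y, P y>. *)
rewrite (ip_conj (S0L _ (TL _ (S0L _ (TL _ fL)))) fL) -adj0 //; last exact/TL/S0L.
rewrite -/y (ip_conj yL (TL _ (S0L _ yL))) adj0 //; last exact: S0L.
rewrite (ip_conj (S0L _ (PL _ yL)) fL) -(adj0 _ _ fL (PL _ yL)).
rewrite -/y lecE => /andP[_].
rewrite ip_self !ReImE /= n2S -PyE => h.
apply: le_trans (csq_ip_le (PL _ yL) yL).
rewrite (ip_conj (PL _ yL) yL) csq_conj /csq.
apply: le_trans (_ : complex.Re (ip mu y (P y)) ^+ 2 <= _); last by rewrite lerDl sqr_ge0.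
by rewrite ler_pXn2r // ?nnegrE ?n2_ge0 // (le_trans _ h) ?n2_ge0.
Qed.

Lemma eigenvector_adjoint T S a f : bounded_op mu T -> is_adjoint mu T S ->
  quasi_star_A mu T -> a != 0 -> inL2 mu f ->
  Defs.ae_eq mu (T f) (fun x => a * f x) ->
  Defs.ae_eq mu (S f) (fun x => a^* * f x).
Proof.
move=> Tb adj quasi a0 fL Tf; have q0 := quasi_star_A_ineq adj quasi Tb fL.
have [Sb adjS] := adj; have [SL Sae _ _] := Sb; have [TL Tae _ _] := Tb.
have ca : 0 < csq a.
  by rewrite lt_neqAle csq_ge0 andbT eq_sym; apply: contra_neq a0 => /csq_eq0.
have step g b : inL2 mu g -> Defs.ae_eq mu g (fun x => b * f x) ->
    Defs.ae_eq mu (T g) (fun x => (b * a) * f x).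
  move=> gL gE; apply: ae_trans (Tae _ _ gL (inL2_scale b fL) gE) _.
  apply: ae_trans (op_scale b Tb fL) _.
  by apply: filterS Tf => x ->; rewrite mulrA.
have TTf := step _ _ (TL _ fL) Tf; have TTTf := step _ _ (TL _ (TL _ fL)) TTf.
have STf : Defs.ae_eq mu (S (T f)) (fun x => a * S f x).
  by apply: ae_trans (op_scale a Sb fL); apply: Sae => //; [exact: TL|exact: inL2_scale].
move: q0; rewrite (ae_n2 _ _ STf) ?(ae_n2 _ _ TTTf) ?(ae_n2 _ _ Tf);
  do ?[exact/TL/TL/TL | exact/SL/TL | exact: TL | exact/inL2_scale/SL | exact: inL2_scale].
rewrite !n2_scale ?csqM //; last exact: SL.
move=> q0.
have q1 : n2 mu (S f) <= csq a * n2 mu f.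
  rewrite -(@ler_pXn2r _ 2) ?nnegrE ?n2_ge0 ?mulr_ge0 ?n2_ge0 ?csq_ge0 //.
  (* The factor |a|^4, positive because a is nonzero, is cancelled from the class inequality at
     [f]. *)
  rewrite -(@ler_pM2l _ (csq a ^+ 2)) ?exprn_gt0 // -exprMn.
  by apply: le_trans q0 _; rewrite le_eqVlt; apply/orP; left; apply/eqP; ring.
(* Since <f, S f> = <T f, f> = a |f|^2, the squared distance from S f to the conjugate multiple of f
   expands to |S f|^2 - |a|^2 |f|^2. *)
apply: n2_sub0 => //; first exact: SL.
rewrite n2_lincomb //; last exact: SL.
rewrite -adjS // (@ae_ip _ _ _ _ _ (fun x => a * f x) f f) //; first last.
- exact: filterE.
- exact: inL2_scale.
- exact: TL.
rewrite scaleE ip_lincombl // ip_self.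
move: q1; rewrite /csq !ReImE /=; nra.
Qed.

(* With [y = T (S f)]: since [f] lies in the kernel it is orthogonal to [S y], which
   is close to [c^* y]; but [<y, f> = |S f|^2]. *)
Lemma kernel_adjoint_estimate T S M eps c f : bounded_op mu T -> is_adjoint mu T S ->
  quasi_star_A mu T -> 1 <= M ->
  (forall g, inL2 mu g -> nrm mu (T g) <= M * nrm mu g) ->
  0 < eps -> eps <= 1 -> inL2 mu f -> Defs.ae_eq mu (T f) (fun=> 0) ->
  nrm mu (lincomb (- c) (T (S f)) (T (T (S f)))) <= eps * nrm mu (T (S f)) ->
  n2 mu (S f) <= 2 * (4 * M + 3) * eps * n2 mu f.
Proof.
move=> Tb adj quasi M1 MT e0 e1 fL Tf0.
have [Sb adjS] := adj; have [SL Sae _ _] := Sb; have [TL Tae lin _] := Tb.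
have zL := SL _ fL; set z := S f in zL *.
have yL := TL _ zL; set y := T z in yL *.
have TyL := TL _ yL; have SyL := SL _ yL; have TTyL := TL _ TyL.
set D := lincomb (- c) y (T y); have DL : inL2 mu D by exact: inL2_lincomb.
have TDL := TL _ DL.
move=> De.
have TyE : T y = lincomb c y D.
  by apply/funext => x; rewrite /D /lincomb; ring.
set Y := nrm mu y in De *; have Y0 : 0 <= Y := nrm_ge0 _ _.
set gam := Num.sqrt (csq c); have gam0 : 0 <= gam by exact: sqrtr_ge0.
have gam2 : gam ^+ 2 = csq c by rewrite sqr_sqrtr // csq_ge0.
have h1 : nrm mu (T y) <= (gam + eps) * Y.
  by rewrite TyE mulrDl (le_trans (nrm_lincomb _ _ _)) // lerD2l.
(* This bound on |c| stays multiplied by [Y], which may still be zero here. *)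
have h1' : gam * Y <= (M + eps) * Y.
  have <- : nrm mu (fun x => c * y x) = gam * Y.
    by rewrite /nrm n2_scale // sqrtrM ?csq_ge0.
  have -> : (fun x => c * y x) = lincomb (-1) D (T y).
    by apply/funext => x; rewrite /D /lincomb; ring.
  apply: le_trans (nrm_lincomb _ _ _) _ => //.
  have -> : csq (-1 : R[i]) = 1 by rewrite /csq !ReImE /=; ring.
  by rewrite sqrtr1 mul1r mulrDl addrC lerD // MT.
have h2 : nrm mu (T (T y)) <= M * (eps * Y) + gam * ((gam + eps) * Y).
  have -> : nrm mu (T (T y)) = nrm mu (lincomb c (T y) (T D)).
    by apply: ae_nrm => //; [exact: inL2_lincomb|rewrite [X in T X]TyE; exact: lin].
  apply: le_trans (nrm_lincomb _ _ _) _ => //.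
  rewrite addrC lerD ?ler_wpM2l //.
  by apply: le_trans (MT _ DL) _; rewrite ler_wpM2l //; lra.
have s0 := n2_ge0 mu (S y).
have h3 : n2 mu (S y) <= nrm mu (T (T y)) * Y.
  rewrite -(@ler_pXn2r _ 2) ?nnegrE ?mulr_ge0 ?nrm_ge0 //.
  by rewrite exprMn !sqr_nrm; exact: (quasi_star_A_ineq adj quasi Tb zL).
(* Cauchy-Schwarz for |y|^2 = <T z, y> = <z, S y>. *)
have h4 : n2 mu y ^+ 2 <= n2 mu z * n2 mu (S y).
  have := csq_ip_le zL SyL; rewrite -adjS // ip_self; apply: le_trans.
  by rewrite /csq /= expr0n addr0.
have yfE : ip mu y f = Complex (n2 mu z) 0 by rewrite adjS // ip_self.
have h5 : n2 mu z ^+ 2 <= n2 mu y * n2 mu f.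
  have := csq_ip_le yL fL; rewrite yfE; apply: le_trans.
  by rewrite /csq /= expr0n addr0.
(* The cross term of the expansion is governed by <y, S y> = <T y, y> = c |y|^2 + <D, y>, where |D|
   <= eps |y|. *)
have h6 : n2 mu (lincomb (- c^*) y (S y)) <=
    n2 mu (S y) - gam ^+ 2 * Y ^+ 2 + 2 * (gam * eps * Y ^+ 2).
  rewrite n2_lincomb // -adjS // TyE ip_lincombl // ip_self.
  set e := ip mu D y.
  have : - complex.Re (c^* * e) <= gam * eps * Y ^+ 2.
    apply: le_trans (ler_norm _) _; rewrite normrN.
    rewrite -(@ler_pXn2r _ 2) ?nnegrE ?normr_ge0 ?mulr_ge0 ?sqr_ge0 //; last exact: ltW.
    rewrite real_normK ?num_real //.
    apply: (@le_trans _ _ (csq (c^* * e))); first by rewrite [leRHS]/csq lerDl sqr_ge0.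
    rewrite csqM csq_conj -gam2 -mulrA exprMn ler_wpM2l ?sqr_ge0 //.
    apply: le_trans (csq_ip_le DL yL) _.
    rewrite -!sqr_nrm exprMn -/Y.
    rewrite [leRHS](_ : _ = (eps * Y) ^+ 2 * Y ^+ 2); last by ring.
    by rewrite ler_wpM2r ?sqr_ge0 // ler_pXn2r // ?nnegrE ?nrm_ge0 // mulr_ge0 // ltW.
  rewrite gam2 sqr_nrm /csq !ReImE /=; lra.
(* As T f = 0, f is orthogonal to S y; its inner product with the difference is therefore -c <f, y>
   = -c |z|^2. *)
have h7 : gam ^+ 2 * n2 mu z ^+ 2 <= n2 mu f * n2 mu (lincomb (- c^*) y (S y)).
  have := csq_ip_le fL (inL2_lincomb (- c^*) yL SyL).
  rewrite ip_lincombr // -adjS //.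
  have -> : ip mu (T f) y = 0.
    rewrite (@ae_ip _ _ _ _ _ (fun x => 0 * y x) y y) //.
    - by rewrite scaleE ip_lincombl // sub0r mulN1r addNr.
    - exact: TL.
    - exact: inL2_scale.
    - by apply: filterS Tf0 => x ->; rewrite mul0r.
    - exact: filterE.
  rewrite addr0 csqM csq_conj (ip_conj fL yL) yfE csq_conj; apply: le_trans.
  by rewrite gam2 /csq !ReImE /= expr0n addr0 !sqrrN.
move: h4 h5 h6 h7; rewrite -[n2 mu y]sqr_nrm -/Y.
set s := n2 mu (S y) in s0 h3 *; set W := n2 mu (lincomb _ _ _).
have := n2_ge0 mu z; have := n2_ge0 mu f; set a := n2 mu z; set x := n2 mu f.
move=> x0 a0 h4 h5 h6 h7.
(* Once |c| <= M + 1 is known, M + 3 |c| <= K; this covers every coefficient of eps below. *)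
set K := 4 * M + 3.
(* If y = 0, then [h5] forces z = 0 and the estimate is trivial. *)
move: Y0; rewrite le_eqVlt => /orP[/eqP Y0|Y0].
  move: h5; rewrite -Y0 expr0n mul0r => a2.
  have /eqP : a ^+ 2 = 0 by apply/le_anti; rewrite a2 sqr_ge0.
  rewrite sqrf_eq0 => /eqP ->; rewrite !mulr_ge0 ?(ltW e0) // /K; lra.
have gamM : gam <= M + 1.
  have : gam <= M + eps by rewrite -(ler_pM2r Y0).
  lra.
have s1 : s <= (gam ^+ 2 + K * eps) * Y ^+ 2.
  apply: le_trans h3 _; apply: le_trans (ler_wpM2r (ltW Y0) h2) _.
  rewrite -subr_ge0 [X in 0 <= X](_ : _ = eps * (K - M - gam) * Y ^+ 2); last by ring.
  by rewrite !mulr_ge0 ?(ltW e0) // ?sqr_ge0 // /K; lra.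
have W1 : W <= K * eps * Y ^+ 2.
  apply: le_trans h6 _; have : s <= (M * eps + gam ^+ 2 + gam * eps) * Y ^+ 2.
    apply: le_trans h3 _; apply: le_trans (ler_wpM2r (ltW Y0) h2) _.
    by rewrite le_eqVlt; apply/orP; left; apply/eqP; ring.
  move=> s2; rewrite -subr_ge0.
  apply: le_trans (_ : 0 <= eps * (K - M - 3 * gam) * Y ^+ 2) _.
    by rewrite !mulr_ge0 ?(ltW e0) // ?sqr_ge0 // /K; lra.
  rewrite -subr_ge0; move: s2; rewrite -subr_ge0 => s2; apply: le_trans s2 _.
  by rewrite le_eqVlt; apply/orP; left; apply/eqP; ring.
(* The summand K eps keeps [q] positive even when c = 0, so that it can be divided out. *)
set q := gam ^+ 2 + K * eps in s1.
have Ke : 0 < K * eps by rewrite mulr_gt0 // /K; lra.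
have q0 : 0 < q by rewrite /q ltr_wpDl ?sqr_ge0.
have Y2 : 0 < Y ^+ 2 by rewrite exprn_gt0.
have Y3 : Y ^+ 2 <= a * q.
  rewrite -(ler_pM2r Y2) -expr2 -mulrA; apply: le_trans h4 _; exact: ler_wpM2l.
(* The part |c|^2 a^2 is bounded by [h7] and [W1], the part K eps a^2 by [h5]; then [Y3] replaces
   |y|^2 by a q, and q a cancels. *)
have a2 : q * a ^+ 2 <= 2 * (K * eps) * (a * q) * x.
  rewrite {1}/q mulrDl.
  apply: le_trans (_ : 2 * (K * eps) * Y ^+ 2 * x <= _); last first.
    by rewrite ler_wpM2r // ler_wpM2l // ltW // mulr_gt0.
  have -> : 2 * (K * eps) * Y ^+ 2 * x = x * (K * eps * Y ^+ 2) + K * eps * (Y ^+ 2 * x) by ring.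
  apply: lerD; first by apply: le_trans h7 _; exact: ler_wpM2l.
  by rewrite ler_wpM2l // ltW.
move: a0; rewrite le_eqVlt => /orP[/eqP <-|a0].
  by rewrite !mulr_ge0 ?(ltW e0) // /K; lra.
rewrite -(ler_pM2l (mulr_gt0 q0 a0)).
move: a2; rewrite [q * a ^+ 2](_ : _ = q * a * a); last by ring.
by move/le_trans; apply; rewrite le_eqVlt; apply/orP; left; apply/eqP; ring.
Qed.

End Operator.

(** * Conditional expectation: uniqueness and restriction to sets of the sub-sigma-algebra *)

Section ConditionalExpectation.
Context {R : realType} {d : measure_display} {X : measurableType d}.
Context (mu : {measure set X -> \bar R}) (A : set (set X)).
Context (sA : sub_sigma_finite mu A).
Local Notation AT := (g_sigma_algebraType A).

(** Since [A] is a sigma-algebra, generating from it adds nothing; general measurability results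
    thus apply to [A] through [AT]. *)
Lemma A_measurableE (B : set X) : measurable (B : set AT) <-> A B.
Proof.
have [sal _ _] := sA.
by rewrite -[X in _ <-> X B](measurable_g_measurableTypeE sal).
Qed.

Lemma A_measurable_sub (B : set X) : A B -> measurable B.
Proof. by have [_ + _] := sA => /[apply]. Qed.

Lemma A_measurableP (g : X -> \bar R) :
  A_measurable A g <-> measurable_fun (setT : set AT) (g : AT -> \bar R).
Proof.
split=> mg.
  by move=> _ Y mY; rewrite setTI; apply/A_measurableE; exact: mg.
by move=> Y mY; apply/A_measurableE; have := mg measurableT _ mY; rewrite setTI.
Qed.

Lemma A_measurable_fun (g : X -> \bar R) : A_measurable A g -> measurable_fun setT g.
Proof. by move=> mg _ Y mY; rewrite setTI; apply: A_measurable_sub; exact: mg. Qed.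

(** The set where p < q is exhausted by sets [D] of [A] having finite measure and on which p is
    bounded. There p and q have the same finite integral, so the positive function q - p integrates
    to 0 and [D] is null. *)
Lemma cexp_nonneg_le h p q : cexp_nonneg mu A h p -> cexp_nonneg mu A h q ->
  {ae mu, forall x, (q x <= p x)%E}.
Proof.
move=> [p0 mp ip] [q0 mq iq]; have [_ _ [F [AF FT Ffin]]] := sA.
pose D nm := F nm.1 `&` ([set x | p x <= (nm.2%:R)%:E]%E `&` [set x | p x < q x]%E).
have AD nm : A (D nm).
  apply/A_measurableE; apply: measurableI; first exact/A_measurableE.
  apply: measurableI.
  - rewrite -[X in measurable X]setTI.
    by apply: measurable_lee => //; exact/A_measurableP.
  - rewrite -[X in measurable X]setTI.
    by apply: measurable_lte => //; exact/A_measurableP.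
have mD nm : measurable (D nm) by exact: A_measurable_sub.
have mpD nm : measurable_fun (D nm) p by apply: measurable_funTS; exact: A_measurable_fun.
have mqD nm : measurable_fun (D nm) q by apply: measurable_funTS; exact: A_measurable_fun.
have negl nm : mu.-negligible (D nm).
  have pq : (\int[mu]_(x in D nm) p x = \int[mu]_(x in D nm) q x)%E.
    by rewrite -ip // -iq.
  have pfin : (\int[mu]_(x in D nm) p x < +oo)%E.
    apply: (@le_lt_trans _ _ (\int[mu]_(x in D nm) (nm.2%:R)%:E)%E).
      by apply: ge0_le_integral => //; move=> x [_ []].
    rewrite integral_cst // -ge0_fin_numE ?mule_ge0 // fin_numM //.
    rewrite ge0_fin_numE //; apply: le_lt_trans (Ffin nm.1).
    by apply: le_measure; rewrite ?inE //; [exact: A_measurable_sub|move=> x []].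
  have inp : mu.-integrable (D nm) p.
    apply/integrableP; split => //.
    by under eq_integral => x _ do rewrite gee0_abs //.
  have inq : mu.-integrable (D nm) q.
    apply/integrableP; split => //.
    by under eq_integral => x _ do rewrite gee0_abs //; rewrite -pq.
  have /(ae_eq_integral_abs mu (mD nm)) : (\int[mu]_(x in D nm) `|(q \- p)%E x| = 0)%E.
    under eq_integral => x /set_mem [_ [xm lt]].
      have px : p x \is a fin_num by rewrite ge0_fin_numE // (le_lt_trans xm) ?ltry.
      rewrite gee0_abs; last by rewrite sube_ge0 ?(ltW lt) // px ?orbT.
      over.
    rewrite integralB // -pq subee // ge0_fin_numE //.
    exact: integral_ge0.
  move=> /(_ (emeasurable_funB (mqD nm) (mpD nm))).
  apply: negligibleS => x Dx /= /(_ Dx); have [_ [xm lt]] := Dx.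
  apply/eqP; rewrite gt_eqF // sube_gt0 //.
have -> : {ae mu, forall x, (q x <= p x)%E} = mu.-negligible (~` [set x | (q x <= p x)%E]) by [].
(* Pairs are enumerated through [pickle]; a number coding no pair falls back to (0, 0) and merely
   repeats a null set. *)
apply: negligibleS (negligible_bigcup (fun k => negl (odflt (0, 0)%N (unpickle k)))).
move=> x /= /negP; rewrite -ltNge => lt.
have [n _ Fn] : (\bigcup_n F n) x by rewrite FT.
(* Being below [q x], the value [p x] is finite, so some natural number bounds it. *)
have pf : p x \is a fin_num by rewrite ge0_fin_numE // (lt_le_trans lt) ?leey.
exists (pickle (n, Num.bound (fine (p x)))) => //; rewrite pickleK /=.
split => //=; split => //=.
by rewrite -{1}(fineK pf) lee_fin ltW // archi_boundP // fine_ge0.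
Qed.

Lemma cexp_nonneg_unique h p q : cexp_nonneg mu A h p -> cexp_nonneg mu A h q ->
  {ae mu, forall x, p x = q x}.
Proof.
move=> hp hq; apply: filterS2 (cexp_nonneg_le hp hq) (cexp_nonneg_le hq hp) => x qp pq.
by apply/le_anti; rewrite pq qp.
Qed.

(** Testing the restricted functions on C amounts to testing the original ones on the intersection
    of C and B. *)
Lemma cexp_nonneg_restrict h p (B : set X) : A B -> cexp_nonneg mu A h p ->
  cexp_nonneg mu A (h \_ B) (p \_ B).
Proof.
move=> AB [p0 mp ip]; split.
- by move=> x; rewrite patchE; case: ifP.
- apply/A_measurableP; have mB : measurable (B : set AT) by exact/A_measurableE.
  by apply/(measurable_restrictT _ mB); apply: measurable_funTS; exact/A_measurableP.
- move=> C AC; rewrite -!integral_mkcondr ip //.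
  by apply/A_measurableE; apply: measurableI; exact/A_measurableE.
Qed.

End ConditionalExpectation.

Definition restrictC {R : realType} {X : Type} (B : set X) (f : X -> R[i]) : X -> R[i] :=
  fun x => if x \in B then f x else 0.

(** * Restriction of square integrable functions to measurable sets *)

Section Restriction.
Context {R : realType} {d : measure_display} {X : measurableType d}.
Context (mu : {measure set X -> \bar R}).
Implicit Types (f g : X -> R[i]) (B : set X).

Lemma l2n2_restrictC B f : l2n2 mu (restrictC B f) = (\int[mu]_(x in B) (csq (f x))%:E)%E.
Proof.
rewrite integral_mkcond; apply: eq_integral => x _; rewrite /restrictC patchE.
by case: ifP => //; rewrite /csq /= expr0n addr0.
Qed.

Lemma inL2_restrictC B f : measurable B -> inL2 mu f -> inL2 mu (restrictC B f).
Proof.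
move=> mB fL; have [[f1 f2] _] := fL.
apply: (inL2_le _ (integrable_csq fL)).
  split; rewrite /restrictC.
  - rewrite (_ : (fun x => _) = fun x => complex.Re (f x) * \1_B x).
      by apply: measurable_funM => //; exact: measurable_indic.
    by apply/funext => x; rewrite indicE; case: (x \in B); rewrite ?mulr1 ?mulr0.
  - rewrite (_ : (fun x => _) = fun x => complex.Im (f x) * \1_B x).
      by apply: measurable_funM => //; exact: measurable_indic.
    by apply/funext => x; rewrite indicE; case: (x \in B); rewrite ?mulr1 ?mulr0.
move=> x; rewrite /restrictC; case: ifP => // _.
by rewrite {1}/csq /= expr0n addr0 csq_ge0.
Qed.

Lemma ip_restrictC B f g : ip mu g (restrictC B f) = ip mu (restrictC B g) f.
Proof.
congr cint; apply/funext => x; rewrite /restrictC; case: ifP => // _.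
by rewrite rmorph0 mulr0 mul0r.
Qed.

(** Testing with h = f - g makes the squared norm of the difference vanish; identities for the
    adjoint are obtained this way. *)
Lemma ip_inj f g : inL2 mu f -> inL2 mu g ->
  (forall h, inL2 mu h -> ip mu h f = ip mu h g) -> Defs.ae_eq mu f g.
Proof.
move=> fL gL fg; have DL : inL2 mu (lincomb (- 1) g f) by exact: inL2_lincomb.
have : Defs.ae_eq mu f (fun x => 1 * g x).
  apply: n2_sub0 => //.
  have := ip_self mu (lincomb (- 1) g f); rewrite ip_lincombr // fg //.
  rewrite rmorphN rmorph1 mulN1r addNr => /(congr1 (@complex.Re R)) /= <-.
  exact: lexx.
by apply: filterS => x ->; rewrite mul1r.
Qed.

Lemma nrm_le_ae f g (e : R) : 0 <= e -> inL2 mu f -> inL2 mu g ->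
  {ae mu, forall x, csq (f x) <= e ^+ 2 * csq (g x)} -> nrm mu f <= e * nrm mu g.
Proof.
move=> e0 fL gL fg.
rewrite -(@ler_pXn2r _ 2) ?nnegrE ?nrm_ge0 ?mulr_ge0 ?nrm_ge0 //.
rewrite exprMn !sqr_nrm -lee_fin EFinM !n2E // -ge0_integralZl_EFin ?sqr_ge0 //.
- have [[fm _] [gm _]] := (fL, gL).
  apply: ae_ge0_le_integral => //.
  + by move=> x _; rewrite lee_fin csq_ge0.
  + by apply/measurable_EFinP; exact: measurable_csq.
  + by move=> x _; rewrite -EFinM lee_fin mulr_ge0 ?csq_ge0 ?sqr_ge0.
  + by apply: measurable_funeM; apply/measurable_EFinP; exact: measurable_csq.
  + by apply: filterS fg => x h _; rewrite -EFinM lee_fin.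
- by move=> x _; rewrite lee_fin csq_ge0.
- by have [gm _] := gL; apply/measurable_EFinP; exact: measurable_csq.
Qed.

(** A countable partition is encoded by a map into [nat], whose fibres are disjoint and cover the
    space by construction. *)
Lemma l2n2_partition f (k : X -> nat) : (forall n, measurable (k @^-1` [set n])) ->
  inL2 mu f ->
  l2n2 mu f = (\sum_(0 <= n <oo) l2n2 mu (restrictC (k @^-1` [set n]) f))%E.
Proof.
move=> mk [fm _].
have kT : \bigcup_n (k @^-1` [set n]) = [set: X].
  by apply/seteqP; split => // x _; exists (k x).
under eq_eseriesr => n _ do rewrite l2n2_restrictC.
rewrite -ge0_integral_bigcup ?kT //.
- by apply/measurable_EFinP; exact: measurable_csq.
- by move=> x _; rewrite lee_fin csq_ge0.
- by move=> m n _ _ [x [<- <-]].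
Qed.

End Restriction.

Lemma ae_and {R : realType} {d : measure_display} {X : measurableType d}
    (mu : {measure set X -> \bar R}) (P Q : X -> Prop) :
  {ae mu, forall x, P x} -> {ae mu, forall x, Q x} -> {ae mu, forall x, P x /\ Q x}.
Proof. by move=> p; apply: filterS2 p => x. Qed.

(** * Locality of the weighted conditional expectation and its action on its range *)

Section WeightedConditionalExpectation.
Context {R : realType} {d : measure_display} {X : measurableType d}.
Context (mu : {measure set X -> \bar R}) (A : set (set X)).
Context (u w : X -> R[i]) (T : (X -> R[i]) -> X -> R[i]).
Context (sA : sub_sigma_finite mu A).
Context (wT : is_wEu mu A w u T).
Context (Tb : bounded_op mu T).
Local Notation AT := (g_sigma_algebraType A).

Lemma wEu_factor f : inL2 mu f -> exists a b : X -> R,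
  [/\ measurable_fun (setT : set AT) (a : AT -> R),
      measurable_fun (setT : set AT) (b : AT -> R) &
      Defs.ae_eq mu (T f) (fun x => w x * Complex (a x) (b x))].
Proof.
move=> fL; have [_ [h [[p1 [n1 [p2 [n2 [[_ mp1 _] [_ mn1 _] [_ mp2 _] [_ mn2 _] hE]]]]] Tf]]] := wT fL.
have mfine (g : X -> \bar R) : A_measurable A g ->
    measurable_fun (setT : set AT) (fun x : AT => fine (g x)).
  move=> mg; apply: measurableT_comp; first exact: fine_measurable.
  exact/(A_measurableP sA).
exists (fun x => fine (p1 x) - fine (n1 x)), (fun x => fine (p2 x) - fine (n2 x)).
split; try by apply: measurable_funB; exact: mfine.
by apply: filterS2 Tf hE => x -> ->.
Qed.

(** Conditional expectation commutes with the indicator of a set of [A]: by uniqueness this holds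
    for the positive and negative parts of Re (u f) and Im (u f), and T f is recovered from these
    four. *)
Lemma wEu_restrictC f (B : set X) : A B -> inL2 mu f ->
  Defs.ae_eq mu (T (restrictC B f)) (restrictC B (T f)).
Proof.
move=> AB fL; have fBL := inL2_restrictC (A_measurable_sub sA AB) fL.
have [_ [h [[p1 [n1 [p2 [n2 [ep1 en1 ep2 en2 hE]]]]] Tf]]] := wT fL.
have [_ [h' [[p1' [n1' [p2' [n2' [ep1' en1' ep2' en2' hE']]]]] Tf']]] := wT fBL.
have uniq (F : R[i] -> R) p p' : F 0 = 0 ->
    cexp_nonneg mu A (fun x => (F (u x * f x))%:E) p ->
    cexp_nonneg mu A (fun x => (F (u x * restrictC B f x))%:E) p' ->
    {ae mu, forall x, p' x = (p \_ B) x}.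
  move=> F0 ep ep'; apply: (cexp_nonneg_unique sA ep').
  rewrite (_ : (fun x => _) = (fun x => (F (u x * f x))%:E) \_ B).
    exact: cexp_nonneg_restrict.
  apply/funext => x; rewrite patchE /restrictC; case: ifP => // _.
  by rewrite mulr0 F0.
have e1 := uniq (fun z => Num.max (complex.Re z) 0) _ _ (maxxx _) ep1 ep1'.
have e2 := uniq (fun z => Num.max (- complex.Re z) 0) _ _ _ en1 en1'.
have e3 := uniq (fun z => Num.max (complex.Im z) 0) _ _ (maxxx _) ep2 ep2'.
have e4 := uniq (fun z => Num.max (- complex.Im z) 0) _ _ _ en2 en2'.
have z0 : Num.max (- (0 : R)) 0 = 0 by rewrite oppr0 maxxx.
have e := ae_and (ae_and e1 (e2 z0)) (ae_and e3 (e4 z0)).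
have Te := ae_and Tf Tf'; have he := ae_and hE hE'.
apply: filterS3 e Te he => x [[e1x e2x] [e3x e4x]] [Tx Tx'] [hx hx'].
rewrite Tx' hx' e1x e2x e3x e4x /restrictC Tx hx !patchE.
case: ifP => // _ /=; rewrite subrr.
by rewrite (_ : Complex 0 0 = 0) ?mulr0.
Qed.

(** Write T f = w g and T (T f) = w g' with g and g' measurable for [A]. The multiplier is g' / g,
    and 0 where g vanishes. *)
Lemma wEu_multiplier f : inL2 mu f -> exists a b : X -> R,
  [/\ measurable_fun (setT : set AT) (a : AT -> R),
      measurable_fun (setT : set AT) (b : AT -> R) &
      Defs.ae_eq mu (T (T f)) (fun x => Complex (a x) (b x) * T f x)].
Proof.
move=> fL; have [TL Tae _ _] := Tb; have TfL := TL _ fL.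
have [a [b [ma mb Ty]]] := wEu_factor fL.
have [a' [b' [ma' mb' TTy]]] := wEu_factor TfL.
pose D x := a x ^+ 2 + b x ^+ 2.
have D0 x : 0 <= D x by rewrite addr_ge0 ?sqr_ge0.
have mD : measurable_fun (setT : set AT) (D : AT -> R).
  by apply: measurable_funD; exact: measurable_funX.
have mDV : measurable_fun (setT : set AT) (fun x : AT => (D x)^-1).
  (* Measurability of the inverse comes from that of real powers, [D] being nonnegative. *)
  rewrite (_ : (fun x => _) = fun x => D x `^ (-1)).
    exact: (measurableT_comp (measurable_powR (-1)) mD).
  by apply/funext => x; rewrite powR_inv1.
(* Real and imaginary parts of g' times the conjugate of g, divided by |g|^2 = [D]; the inverse of 0
   is 0. *)
exists (fun x => (a' x * a x + b' x * b x) * (D x)^-1).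
exists (fun x => (b' x * a x - a' x * b x) * (D x)^-1).
split.
- apply: measurable_funM => //; apply: measurable_funD; exact: measurable_funM.
- apply: measurable_funM => //; apply: measurable_funB; exact: measurable_funM.
(* Where [D = 0] the factor of [T f] vanishes, so locality makes [T (T f)] vanish. *)
pose N : set X := D @^-1` [set 0].
have AN : A N.
  apply/(A_measurableE sA); rewrite -[X in measurable X]setTI; exact: mD.
have TN := wEu_restrictC AN TfL.
have TN0 : Defs.ae_eq mu (T (restrictC N (T f))) (fun=> 0).
  have yN0 : Defs.ae_eq mu (restrictC N (T f)) (fun x => 0 * T f x).
    apply: filterS Ty => x; rewrite /restrictC mul0r; case: ifP => // /set_mem.
    rewrite /N /= => Dx0 ->; have := D0 x; move/eqP: Dx0.
    rewrite /D paddr_eq0 ?sqr_ge0 // !sqrf_eq0 => /andP[/eqP -> /eqP ->] _.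
    by rewrite (_ : Complex 0 0 = 0) ?mulr0.
  apply: ae_trans (Tae _ _ _ _ yN0) _.
  - exact (inL2_restrictC (A_measurable_sub sA AN) TfL).
  - exact: inL2_scale.
  - by apply: ae_trans (op_scale 0 Tb TfL) _; apply: filterS TN => x _; rewrite mul0r.
have TT0 := ae_and TN TN0.
apply: filterS3 Ty TTy TT0 => x Tx TTx [TNx TN0x].
have [Dx|Dx] := eqVneq (D x) 0.
  rewrite Dx invr0 !mulr0 (_ : Complex 0 0 = 0) // mul0r.
  move: TNx; rewrite TN0x /restrictC; case: ifP => [_ <-//|/negP].
  by case; rewrite inE /N /= Dx.
rewrite TTx Tx; move: Dx; rewrite /D => Dx.
apply: complexP; rewrite !ReImE /=; field; exact: Dx.
Qed.

End WeightedConditionalExpectation.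

(** * A square grid in the complex plane *)

Section Cells.
Context {R : realType} {X : Type}.
Context (a b : X -> R) (del : R).

(** The grid square of side [del] containing a + i b, coded as a natural number so that the cells
    form a countable family. *)
Definition cell_index (x : X) : nat :=
  pickle (Num.floor (a x / del), Num.floor (b x / del)).

(** Each coordinate varies by at most [del] in a cell. The bound is rounded up to a perfect square,
    the form taken by [nrm_le_ae]. *)
Lemma cell_index_close x y : 0 < del -> cell_index x = cell_index y ->
  csq (Complex (a x) (b x) - Complex (a y) (b y)) <= (2 * del) ^+ 2.
Proof.
move=> del0 /(pcan_inj pickleK) [ea eb].
have close (s t : R) : Num.floor (s / del) = Num.floor (t / del) -> (s - t) ^+ 2 <= del ^+ 2.
  move=> e; have := floor_itv (s / del); have := floor_itv (t / del); rewrite e.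
  rewrite intrD !ler_pdivlMr // !ltr_pdivrMr //.
  move: (_%:~R) => k /andP[t1 t2] /andP[s1 s2].
  rewrite -subr_ge0 subr_sqr mulr_ge0 //; lra.
have := close _ _ ea; have := close _ _ eb.
rewrite /csq /=; nra.
Qed.

End Cells.

Lemma measurable_cell_index {R : realType} {d : measure_display} {X : measurableType d}
    (a b : X -> R) (del : R) n :
  0 < del -> measurable_fun setT a -> measurable_fun setT b ->
  measurable (cell_index a b del @^-1` [set n]).
Proof.
move=> del0 ma mb.
have mf (c : X -> R) (k : int) : measurable_fun setT c ->
    measurable [set x | Num.floor (c x / del) = k].
  move=> mc; rewrite (_ : [set x | _] = setT `&` c @^-1` `[k%:~R * del, (k + 1)%:~R * del[).
    by apply: mc => //; exact: measurable_itv.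
  apply/seteqP; split => x /=; rewrite in_itv /=.
    by move=> <-; split=> //; have := floor_itv (c x / del); rewrite ler_pdivlMr // ltr_pdivrMr.
  by move=> [_ h]; apply/floor_def; rewrite ler_pdivlMr // ltr_pdivrMr.
(* A nonempty fibre is described by the floors at any one of its points, which avoids decoding
   [n]. *)
have [[x0 xn]|no] := pselect (exists x, cell_index a b del x = n); last first.
  rewrite (_ : _ @^-1` _ = set0) //; apply/seteqP; split => // x xn.
  by case: no; exists x.
rewrite (_ : _ @^-1` _ = [set x | Num.floor (a x / del) = Num.floor (a x0 / del)] `&`
   [set x | Num.floor (b x / del) = Num.floor (b x0 / del)]).
  by apply: measurableI; exact: mf.
apply/seteqP; split => x /=; rewrite -xn.
  by move=> /(pcan_inj pickleK) [].
by rewrite /cell_index => -[-> ->].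
Qed.

(** * The kernel of T lies in the kernel of its adjoint *)

Section Kernel.
Context {R : realType} {d : measure_display} {X : measurableType d}.
Context (mu : {measure set X -> \bar R}) (A : set (set X)).
Context (u w : X -> R[i]) (T S : (X -> R[i]) -> X -> R[i]).
Context (sA : sub_sigma_finite mu A).
Context (wT : is_wEu mu A w u T).
Context (Tb : bounded_op mu T).
Context (adj : is_adjoint mu T S).
Context (quasi : quasi_star_A mu T).

(** Dual to the locality of T: <h, S (1_B f)> = <1_B T h, f> = <T (1_B h), f> = <h, 1_B S f> for
    every h. *)
Lemma adjoint_restrictC f (B : set X) : A B -> inL2 mu f ->
  Defs.ae_eq mu (S (restrictC B f)) (restrictC B (S f)).
Proof.
move=> AB fL; have mB := A_measurable_sub sA AB.
have [[SL _ _ _] adjS] := adj; have [TL Tae _ _] := Tb.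
have fBL := inL2_restrictC mB fL.
apply: ip_inj; [exact: SL|by apply: inL2_restrictC => //; exact: SL|].
move=> h hL; have hBL := inL2_restrictC mB hL.
rewrite -adjS // !ip_restrictC -adjS //; apply: ae_ip => //.
- by apply: inL2_restrictC => //; exact: TL.
- exact: TL.
- by apply: ae_sym; exact: (wEu_restrictC sA wT).
- exact: filterE.
Qed.

Lemma kernel_adjoint f : inL2 mu f -> Defs.ae_eq mu (T f) (fun=> 0) ->
  Defs.ae_eq mu (S f) (fun=> 0).
Proof.
move=> fL Tf0; have [M M1 MT] := op_nrm_bound Tb.
have [[SL Sae _ _] adjS] := adj; have [TL Tae _ _] := Tb.
have zL := SL _ fL; have yL := TL _ zL.
have [a [b [ma mb phi]]] := wEu_multiplier sA wT Tb zL.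
pose K := 2 * (4 * M + 3).
have K0 : 0 < K by rewrite /K; lra.
have est eps : 0 < eps -> eps <= 1 -> n2 mu (S f) <= K * eps * n2 mu f.
  (* Cells of side eps / 2 make the bound of [cell_index_close] equal to eps^2. *)
  move=> e0 e1; pose k := cell_index a b (eps / 2).
  have del0 : 0 < eps / 2 by rewrite divr_gt0.
  have Ak n : A (k @^-1` [set n]).
    by apply/(A_measurableE sA); exact: (@measurable_cell_index _ _ (g_sigma_algebraType A)).
  have mk n : measurable (k @^-1` [set n]) by exact (A_measurable_sub sA (Ak n)).
  have cell n : n2 mu (restrictC (k @^-1` [set n]) (S f)) <=
      K * eps * n2 mu (restrictC (k @^-1` [set n]) f).
    set B := k @^-1` [set n]; have mB : measurable B := mk n.
    have AB : A B := Ak n.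
    have fBL : inL2 mu (restrictC B f) by exact: inL2_restrictC.
    have SB : Defs.ae_eq mu (S (restrictC B f)) (restrictC B (S f)).
      exact: adjoint_restrictC.
    have zBL : inL2 mu (restrictC B (S f)) by exact: inL2_restrictC.
    have yBL : inL2 mu (restrictC B (T (S f))) by exact: inL2_restrictC.
    have TSB : Defs.ae_eq mu (T (S (restrictC B f))) (restrictC B (T (S f))).
      apply: ae_trans (Tae _ _ (SL _ fBL) zBL SB) _.
      exact: (wEu_restrictC sA wT).
    have TTSB : Defs.ae_eq mu (T (T (S (restrictC B f)))) (restrictC B (T (T (S f)))).
      apply: ae_trans (Tae _ _ (TL _ (SL _ fBL)) yBL TSB) _.
      exact: (wEu_restrictC sA wT).
    have TB0 : Defs.ae_eq mu (T (restrictC B f)) (fun=> 0).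
      apply: ae_trans (wEu_restrictC sA wT (Ak n) fL) _.
      by apply: filterS Tf0 => x; rewrite /restrictC => ->; rewrite if_same.
    rewrite -(ae_n2 (SL _ fBL) zBL SB).
    (* A nonempty cell provides the constant c as the value of the multiplier at one of its points;
       on an empty cell the restriction is zero. *)
    have [[x0 xn]|no] := pselect (exists x, k x = n); last first.
      rewrite (ae_n2 (SL _ fBL) zBL SB) [X in n2 mu X <= _](_ : _ = fun x => 0 * S f x).
        rewrite n2_scale // /csq /= expr0n addr0 mul0r.
        exact: mulr_ge0 (mulr_ge0 (ltW K0) (ltW e0)) (n2_ge0 _ _).
      apply/funext => x; rewrite /restrictC mul0r; case: ifP => // /set_mem xn.
      by case: no; exists x.
    apply: (kernel_adjoint_estimate (c := Complex (a x0) (b x0)) Tb adj quasi M1 MT) => //.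
    apply: nrm_le_ae; first exact: ltW.
    - by apply: inL2_lincomb; [exact/TL/SL|exact/TL/TL/SL].
    - exact/TL/SL.
    - apply: filterS3 TSB TTSB phi => x e2 e3 e4.
      rewrite /lincomb e2 e3 /restrictC; case: ifP => [/set_mem xB|_]; last first.
        by rewrite mulr0 addr0 /csq /= expr0n addr0 mulr0.
      rewrite e4 -mulrDl csqM addrC ler_wpM2r ?csq_ge0 //.
      have -> : eps = 2 * (eps / 2) by field.
      by apply: cell_index_close => //; rewrite -/k xn.
  (* The constant K eps is the same for all cells, so the cell estimates add up to the global
     one. *)
  rewrite -lee_fin EFinM !n2E // (l2n2_partition mk zL) (l2n2_partition mk fL).
  rewrite -nneseriesZl; last by move=> n _; exact: l2n2_ge0.
  apply: lee_nneseries => [n _ _|n _]; first exact: l2n2_ge0.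
  rewrite -!n2E; first by rewrite -EFinM lee_fin.
  - exact: inL2_restrictC (mk n) fL.
  - exact: inL2_restrictC (mk n) zL.
apply: n2_eq0 => //; apply/le_anti; rewrite n2_ge0 andbT leNgt; apply/negP => z0.
have x0 := n2_ge0 mu f.
have c0 : 0 <= K * n2 mu f by rewrite mulr_ge0 // ltW.
have den0 : 0 < n2 mu (S f) + K * n2 mu f + 1 by lra.
(* With n = |S f|^2 > 0 and m = K |f|^2, the choice eps = n / (n + m + 1) gives eps m < n,
   contradicting the estimate. *)
have := est (n2 mu (S f) / (n2 mu (S f) + K * n2 mu f + 1)).
rewrite divr_gt0 // ler_pdivrMr // mul1r => /(_ isT).
have -> : n2 mu (S f) <= n2 mu (S f) + K * n2 mu f + 1 by lra.
move=> /(_ isT); rewrite leNgt => /negP; apply.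
rewrite mulrAC mulrA ltr_pdivrMr // mulrC ltr_pM2l //; lra.
Qed.

End Kernel.

(** * Equality of the two spectra, by cases on whether the eigenvalue is zero *)

Theorem theorem3p4 (R : realType) (d : measure_display) (X : measurableType d)
  (mu : {measure set X -> \bar R}) (A : set (set X)) (u w : X -> R[i])
  (T : (X -> R[i]) -> (X -> R[i])) :
  complete_measure mu -> sigma_finite setT mu -> sub_sigma_finite mu A ->
  in_DE mu A u -> in_DE mu A w ->
  is_wEu mu A w u T -> bounded_op mu T ->
  quasi_star_A mu T ->
  forall S, is_adjoint mu T S -> sigma_p mu T = sigma_jp mu T S.
Proof.
move=> _ _ sA _ _ wT Tb quasi S adj; apply/seteqP; split => l [x]; last first.
  by move=> [xL x1 Tx _]; exists x.
move=> [xL x1 Tx]; exists x; split => //.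
have [l0|l0] := eqVneq l 0; last exact: eigenvector_adjoint Tx.
have /(kernel_adjoint sA wT Tb adj quasi xL) : Defs.ae_eq mu (T x) (fun=> 0).
  by apply: filterS Tx => y ->; rewrite l0 mul0r.
by apply: filterS => y ->; rewrite l0 rmorph0 mul0r.
Qed.
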